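(* The frame property $(c)$ is undefinable in $\mathcal{L}(\bullet)$, and the frame property $(r)$ is undefinable in $\mathcal{L}(\bullet)$.
   Context: Fix a nonempty set $\mathbf{P}$ of propositional variables, $p\in\mathbf{P}$. $\mathcal{L}(\bullet)$: $\varphi::=p\mid\neg\varphi\mid\varphi\land\varphi\mid\bullet\varphi$. A neighborhood frame is $\mathcal{F}=\langle S,N\rangle$ with $S$ a nonempty set and $N:S\to\mathcal{P}(\mathcal{P}(S))$; a model $\mathcal{M}=\langle S,N,V\rangle$ based on $\mathcal{F}$ adds a valuation $V:\mathbf{P}\to\mathcal{P}(S)$. With $\varphi^{\mathcal{M}}=\{s\in S\mid\mathcal{M},s\vDash\varphi\}$: $\mathcal{M},s\vDash p$ iff $s\in V(p)$; Boolean connectives as usual; $\mathcal{M},s\vDash\bullet\varphi$ iff $s\in\varphi^{\mathcal{M}}$ and $\varphi^{\mathcal{M}}\notin N(s)$. $\mathcal{F}\vDash\varphi$ means $\mathcal{M},s\vDash\varphi$ for all models $\mathcal{M}$ based on $\mathcal{F}$ and all $s\in S$; $\mathcal{F}\vDash\Theta$ means $\mathcal{F}\vDash\varphi$ for all $\varphi\in\Theta$. Frame properties: $\mathcal{F}$ has $(c)$ if for all $s\in S$, $X,Y\in N(s)$ imply $X\cap Y\in N(s)$; $\mathcal{F}$ has $(r)$ if for all $s\in S$, $\bigcap N(s)\in N(s)$. A frame property $P$ is definable in a language $\mathcal{L}$ if there is a set $\Theta\subseteq\mathcal{L}$ such that for every frame $\mathcal{F}$: $\mathcal{F}\vDash\Theta$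 iff $\mathcal{F}$ has $P$; otherwise it is undefinable. *)

(* Defs.v *)
From mathcomp Require Import all_boot.
From mathcomp Require Import boolp classical_sets.

Set Implicit Arguments.
Unset Strict Implicit.
Unset Printing Implicit Defensive.

Local Open Scope classical_set_scope.

Inductive form (P : Type) : Type :=
| Var of P
| Neg of form P
| And of form P & form P
| Bullet of form P.

Record frame : Type := Frame {
  state :> Type;
  state_nonempty : inhabited state;
  nbhd : state -> set (set state)
}.

Record model (P : Type) : Type := Model {
  model_frame :> frame;
  valuation : P -> set model_frame
}.
Arguments valuation {P} m _ _.

(* Sets are predicates, so the truth set of [phi] is also its satisfaction relation:
   [truth M phi s] is M,s |= phi. *)
Fixpoint truth (P : Type) (M : model P) (phi : form P) : set M :=
  match phi with
  | Var p => valuation M p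
  | Neg psi => [set s | ~ @truth P M psi s]
  | And psi chi => [set s | @truth P M psi s /\ @truth P M chi s]
  | Bullet psi => [set s | @truth P M psi s /\ ~ nbhd s (@truth P M psi)]
  end.
Arguments truth {P} M phi _.

Definition valid (P : Type) (F : frame) (phi : form P) : Prop :=
  forall (V : P -> set F) (s : F), truth (@Model P F V) phi s.

Definition valid_set (P : Type) (F : frame) (Theta : set (form P)) : Prop :=
  forall phi, Theta phi -> valid F phi.

Definition definable (P : Type) (Q : frame -> Prop) : Prop :=
  exists Theta : set (form P), forall F : frame, valid_set F Theta <-> Q F.

Definition property_c (F : frame) : Prop :=
  forall (s : F) (X Y : set F),
    nbhd s X -> nbhd s Y -> nbhd s (X `&` Y).

(* If N(s) is empty, the intersection of N(s) is the whole set of states. *)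
Definition property_r (F : frame) : Prop :=
  forall s : F, nbhd s (\bigcap_(X in nbhd s) X).

(* Main.v *)
Require Import Defs.
From mathcomp Require Import all_boot.
From mathcomp Require Import boolp classical_sets.

(** The clause for [Bullet] only asks whether a set containing [s] belongs to
    [N s], so neighborhoods of [s] that omit [s] are invisible to the language.
    On a three-point set, the frame whose only neighborhood is the whole set has
    both properties; adding to each [N s] the singletons [{x}] with [x <> s]
    destroys both, since the intersection of two of them is empty. *)

Set Implicit Arguments.
Unset Strict Implicit.
Unset Printing Implicit Defensive.

Local Open Scope classical_set_scope.

Definition agree_at_members (T : Type) (N N' : T -> set (set T)) : Prop :=
  forall (s : T) (X : set T), X s -> (N s X <-> N' s X).

(** By induction on [phi], only [Bullet] consults the neighborhoods, and it does so at points that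
    already lie in the truth set, where [N] and [N'] agree. *)
Lemma truth_agree (P T : Type) (h : inhabited T) (N N' : T -> set (set T))
    (V : P -> set T) (phi : form P) :
  agree_at_members N N' ->
  @truth P (@Model P (Frame h N) V) phi = @truth P (@Model P (Frame h N') V) phi.
Proof.
move=> NN'; elim: phi => [//|phi /= -> //|phi /= -> psi -> //|phi /= ->].
apply/seteqP; split=> s /= [phis nN]; split=> // Nphi; apply: nN;
  exact/(NN' s).
Qed.

(** Both frames carry the same valuations, so any [Theta] valid on the first is valid on the second
    and cannot separate them. *)
Lemma undefinable_agree (P T : Type) (h : inhabited T) (N N' : T -> set (set T))
    (Q : frame -> Prop) :
  agree_at_members N N' -> Q (Frame h N) -> ~ Q (Frame h N') -> ~ definable P Q.
Proof.
move=> NN' QN nQN' [Theta defQ]; apply/nQN'/defQ => phi Tphi V s.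
by rewrite -(truth_agree h V phi NN'); apply: (proj2 (defQ _) QN).
Qed.

Definition unit_nbhd (T : Type) (s : T) : set (set T) := [set setT].

Definition punctured_nbhd (T : Type) (s : T) : set (set T) :=
  [set X | X = setT \/ exists2 x, x <> s & X = [set x]].

Lemma unit_punctured_agree (T : Type) :
  agree_at_members (@unit_nbhd T) (@punctured_nbhd T).
Proof.
move=> s X Xs; split=> [|[//|[x xs XE]]]; first by left.
by move: Xs; rewrite XE => /esym.
Qed.

Lemma unit_nbhd_c (T : Type) (h : inhabited T) :
  property_c (Frame h (@unit_nbhd T)).
Proof. by move=> s X Y /= -> ->; rewrite setIT. Qed.

Lemma unit_nbhd_r (T : Type) (h : inhabited T) :
  property_r (Frame h (@unit_nbhd T)).
Proof. by move=> s /=; rewrite /unit_nbhd bigcap_set1. Qed.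

(** Either closure property would force the empty set to be a neighborhood; but [setT] contains [s]
    and singletons are inhabited. *)
Lemma punctured_nbhd_set0 (T : Type) (s : T) : ~ punctured_nbhd s set0.
Proof.
move=> [E|[x _ E]]; first by have: @setT T s by []; rewrite -E.
by have: [set x] x by []; rewrite -E.
Qed.

Lemma punctured_nbhd_not_c (T : Type) (h : inhabited T) (s x y : T) :
  x <> s -> y <> s -> x <> y -> ~ property_c (Frame h (@punctured_nbhd T)).
Proof.
move=> xs ys xy /(_ s [set x] [set y]) /= Nxy.
apply: (@punctured_nbhd_set0 T s).
suff <- : [set x] `&` [set y] = set0.
  by apply: Nxy; right; [exists x | exists y].
by apply/seteqP; split=> // z [/= -> /xy].
Qed.

Lemma punctured_nbhd_not_r (T : Type) (h : inhabited T) (s x y : T) :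
  x <> s -> y <> s -> x <> y -> ~ property_r (Frame h (@punctured_nbhd T)).
Proof.
move=> xs ys xy /(_ s) /= Ncap.
apply: (@punctured_nbhd_set0 T s).
suff <- : \bigcap_(X in punctured_nbhd s) X = set0 by [].
(* A point [z] of the intersection lies in both singleton neighborhoods, so [x = z = y]. *)
apply/seteqP; split=> // z zcap; apply: xy.
have /= <- : [set x] z by apply: zcap; right; exists x.
by apply: (zcap [set y]); right; exists y.
Qed.

Theorem proposition4p5 (P : Type) (P_nonempty : inhabited P) :
  ~ definable P property_c /\ ~ definable P property_r.
Proof.
(* [option bool] serves as the three-point set; both properties fail at [None], which leaves two
   distinct other points. *)
have h : inhabited (option bool) := inhabits None.
split; apply: (undefinable_agree (h := h) (@unit_punctured_agree _)).
- exact: unit_nbhd_c.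
- exact: (@punctured_nbhd_not_c _ _ None (Some true) (Some false)).
- exact: unit_nbhd_r.
- exact: (@punctured_nbhd_not_r _ _ None (Some true) (Some false)).
Qed.
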